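(* Let $\mathbb{F}\in\{\mathbb{R},\mathbb{C}\}$, let $\mathcal{X}=\mathrm{span}\{X_1,\dots,X_k\}\subset\mathbb{F}^{n\times n}$ be a $k$-dimensional subspace, and let $Y\in\mathbb{F}^{n\times n}\setminus\mathcal{X}$ and $X_*\in\mathcal{X}$ be given. Define $$A_i=(Y-X_* )^HX_i,\ i=1,\dots,k,\qquad A_Y=(Y-X_* )^HY,\qquad \varrho=\|Y-X_*\|_2^2,$$ and let $e_1\in\mathbb{R}^{k+1}$ be the first column of the identity matrix. Then $$0\in\mathrm{cvx}\left(\mathscr{F}(A_1,\dots,A_k;\Sigma_{Y-X_*})\right)$$ holds if and only if $$\varrho\,e_1\in\mathrm{cvx}\left(\mathscr{F}(A_Y,A_1,\dots,A_k)\right),$$ where $\mathrm{cvx}$ denotes the convex hull.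
   Context: $\|v\|_2=(v^Hv)^{1/2}$ is the Euclidean norm on $\mathbb{F}^n$ and $\|A\|_2=\max_{v\in\mathbb{F}^n,\,\|v\|_2=1}\|Av\|_2$ is the spectral norm on $\mathbb{F}^{n\times n}$; $^H$ denotes the conjugate transpose. For an integer $m\ge 1$, matrices $B_1,\dots,B_m\in\mathbb{F}^{n\times n}$ and a subspace $\mathcal{S}\subseteq\mathbb{F}^n$ (over the same field $\mathbb{F}$), the $m$-dimensional field of the $m$ matrices $B_1,\dots,B_m$ restricted to $\mathcal{S}$ is $$\mathscr{F}(B_1,\dots,B_m;\mathcal{S})=\left\{[v^HB_1v,\dots,v^HB_mv]^T:\ v\in\mathcal{S},\ \|v\|_2=1\right\}\subset\mathbb{F}^m,$$ and $\mathscr{F}(B_1,\dots,B_m)=\mathscr{F}(B_1,\dots,B_m;\mathbb{F}^n)$. $\Sigma_{Y-X_*}\subseteq\mathbb{F}^n$ denotes the span of the maximal right singular vectors of $Y-X_*$, i.e., of the right singular vectors corresponding to the maximal singular value $\|Y-X_*\|_2$ of $Y-X_*$. *)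

(* Defs.v *)
From HB Require Import structures.
From mathcomp Require Import all_boot all_order all_algebra.
From mathcomp Require Import complex.
From mathcomp Require Import classical_sets reals.

Set Implicit Arguments.
Unset Strict Implicit.
Unset Printing Implicit Defensive.

Import Order.TTheory GRing.Theory Num.Theory.
Local Open Scope classical_set_scope.
Local Open Scope ring_scope.

(* The two cases FF = R and FF = C are treated uniformly: [base_field R K] is the
   scalar field selected by [K], over an arbitrary model [R] of the reals. *)
Inductive scalar_kind := RealScalars | ComplexScalars.

Definition base_field (R : realType) (K : scalar_kind) : numFieldType :=
  match K with
  | RealScalars => R : numFieldType
  | ComplexScalars => R[i] : numFieldType
  end.

Definition sconj (R : realType) (K : scalar_kind) :
    base_field R K -> base_field R K :=
  match K return base_field R K -> base_field R K with
  | RealScalars => fun x : R => x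
  | ComplexScalars => fun z : R[i] => conjc z
  end.

Definition sRe (R : realType) (K : scalar_kind) : base_field R K -> R :=
  match K return base_field R K -> R with
  | RealScalars => fun x : R => x
  | ComplexScalars => fun z : R[i] => complex.Re z
  end.

Definition of_real (R : realType) (K : scalar_kind) : R -> base_field R K :=
  match K return R -> base_field R K with
  | RealScalars => fun x : R => x
  | ComplexScalars => fun x : R => real_complex R x
  end.
Arguments of_real {R} K x.

Section Definitions.
Context {R : realType} {K : scalar_kind}.
Local Notation F := (base_field R K).

Definition ctrmx m n (A : 'M[F]_(m, n)) : 'M[F]_(n, m) :=
  (map_mx (@sconj R K) A)^T.

(* v^H v is a nonnegative real scalar; [sRe] only changes its type to [R]. *)
Definition norm2 n (v : 'cV[F]_n) : R :=
  Num.sqrt (sRe ((ctrmx v *m v) ord0 ord0)).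

(* For 0 < n the supremum is a maximum, by compactness of the unit sphere. *)
Definition spectral_norm n (A : 'M[F]_n) : R :=
  sup [set norm2 (A *m v) | v in [set v : 'cV[F]_n | norm2 v = 1]].

Definition right_singular_vector n (A : 'M[F]_n) (s : R) (v : 'cV[F]_n) :
    Prop :=
  norm2 v = 1 /\
  exists u : 'cV[F]_n,
    [/\ norm2 u = 1, A *m v = of_real K s *: u
      & ctrmx A *m u = of_real K s *: v].

Definition lin_span n (S : set 'cV[F]_n) : set 'cV[F]_n :=
  [set v | exists (p : nat) (c : 'I_p -> F) (w : 'I_p -> 'cV[F]_n),
     (forall j, S (w j)) /\ v = \sum_(j < p) c j *: w j].

Definition max_right_singular_space n (A : 'M[F]_n) : set 'cV[F]_n :=
  lin_span [set v | right_singular_vector A (spectral_norm A) v].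

Definition field_on n m (B : m.-tuple 'M[F]_n) (S : set 'cV[F]_n) :
    set 'cV[F]_m :=
  [set \col_(i < m) (ctrmx v *m tnth B i *m v) ord0 ord0
     | v in [set v : 'cV[F]_n | S v /\ norm2 v = 1]].

Definition field_of n m (B : m.-tuple 'M[F]_n) : set 'cV[F]_m :=
  field_on B setT.

(* Convex combinations have real weights, also over the complex numbers. *)
Definition cvx m (S : set 'cV[F]_m) : set 'cV[F]_m :=
  [set x | exists (p : nat) (t : 'I_p -> R) (w : 'I_p -> 'cV[F]_m),
     [/\ forall j, 0 <= t j, \sum_(j < p) t j = 1, forall j, S (w j)
       & x = \sum_(j < p) of_real K (t j) *: w j]].

End Definitions.

(* Main.v *)
Require Import Defs.
From mathcomp Require Import all_boot all_order all_algebra.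
From mathcomp Require Import classical_sets reals.
From HB Require Import structures.
From mathcomp Require Import complex boolp ring lra.

Set Implicit Arguments.
Unset Strict Implicit.
Unset Printing Implicit Defensive.

Import Order.TTheory GRing.Theory Num.Theory.
Local Open Scope ring_scope.

(** Write [D = Y - Xs], [s = spectral_norm D], so that [rho = s ^+ 2].

    Membership in either convex hull is a statement about weights [t j] and unit
    vectors [v j], and both hulls only see them through the linear functional
    [mean_form t v : M |-> \sum_j t j * (v j)^H M (v j)] ([cvx_fieldP]).  If
    [mean_form t v] vanishes at all the [D^H X_i], it vanishes at [D^H Xs] by
    linearity ([mean_form_span]); since [D^H Y = D^H D + D^H Xs], its value at
    [D^H Y] is then the weighted mean of the numbers [|D v_j|^2].

    So the second condition says that the first one holds with arbitrary unit
    vectors, and that in addition the mean of the [|D v_j|^2] is [s ^+ 2].  Each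
    of these numbers is at most [s ^+ 2] ([sqnorm_le_spectral]), and a mean reaches
    an upper bound only if all terms of nonzero weight reach it ([mean_eq_max]).
    It remains to see that, among unit vectors, those with [|D v| = s] are
    exactly those in the span of the maximal right singular vectors.  A vector
    of that span satisfies [D^H D v = s ^+ 2 v] ([singular_space_eigen]), hence
    [|D v|^2 = s ^+ 2].  Conversely a maximizer of [|D v|] satisfies this
    eigenvector equation by a first variation argument ([maximizer_eigen]), and
    then it is itself a right singular vector, with left singular vector
    [D v / s] ([maximizer_singular]); here [s] is positive because [Y] is not
    in the span of [X]. *)

(** * Weighted means *)

Section WeightedMeans.
Variable R : numDomainType.

Lemma weight_neq0 p (t : 'I_p -> R) : \sum_j t j = 1 -> exists j, t j != 0.
Proof.
move=> t1; apply/existsP; apply: contra_eqT t1.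
rewrite negb_exists => /forallP t0.
by rewrite big1 ?(eq_sym 0) ?oner_neq0 // => j _; apply/eqP/negPn.
Qed.

(** The nonnegative gaps [M - a j] have weighted sum zero, so each weighted gap
    is zero. *)
Lemma mean_eq_max p (t a : 'I_p -> R) M :
  (forall j, 0 <= t j) -> \sum_j t j = 1 -> (forall j, a j <= M) ->
  \sum_j t j * a j = M -> forall j, t j != 0 -> a j = M.
Proof.
move=> t_ge0 t1 aM mean j tj.
have /eqP : \sum_j t j * (M - a j) = 0.
  under eq_bigr do rewrite mulrBr.
  by rewrite sumrB -mulr_suml t1 mul1r mean subrr.
rewrite psumr_eq0 => [/allP/(_ j)|l _]; last by rewrite mulr_ge0 ?subr_ge0.
rewrite mem_index_enum mulf_eq0 (negPf tj) subr_eq0.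
by move=> /(_ isT)/eqP.
Qed.

End WeightedMeans.

(** * Real and complex scalars *)

Section Scalars.
Variables (R : realType) (K : scalar_kind).
Local Notation F := (base_field R K).

(** The algebra of conjugation, real part and the embedding of the reals is
    recorded here once; with it, no later argument distinguishes the real case
    from the complex one. *)
Fact sconj_is_zmod_morphism : zmod_morphism (@sconj R K).
Proof. by case: K => //= x y; rewrite raddfB. Qed.

Fact sconj_is_monoid_morphism : monoid_morphism (@sconj R K).
Proof.
by case: K; split=> //; [exact: (rmorph1 (@conjc R)) | exact: (rmorphM (@conjc R))].
Qed.

HB.instance Definition _ := GRing.isZmodMorphism.Build F F (@sconj R K)
  sconj_is_zmod_morphism.
HB.instance Definition _ := GRing.isMonoidMorphism.Build F F (@sconj R K)
  sconj_is_monoid_morphism.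

Fact of_real_is_zmod_morphism : zmod_morphism (@of_real R K).
Proof. by case: K => //= x y; rewrite raddfB. Qed.

Fact of_real_is_monoid_morphism : monoid_morphism (@of_real R K).
Proof. by case: K; split=> // x y; exact: (rmorphM (real_complex R)). Qed.

HB.instance Definition _ := GRing.isZmodMorphism.Build R F (@of_real R K)
  of_real_is_zmod_morphism.
HB.instance Definition _ := GRing.isMonoidMorphism.Build R F (@of_real R K)
  of_real_is_monoid_morphism.

Fact sRe_is_zmod_morphism : zmod_morphism (@sRe R K).
Proof. by case: K => //= x y; rewrite raddfB. Qed.

HB.instance Definition _ := GRing.isZmodMorphism.Build F R (@sRe R K)
  sRe_is_zmod_morphism.

Lemma sconjK : involutive (@sconj R K).
Proof. by case: K => //= x; rewrite conjcK. Qed.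

Lemma sRe_conj (z : F) : sRe (sconj z) = sRe z.
Proof. by case: K z => //= -[]. Qed.

Lemma sRe_of_realM (r : R) (z : F) : sRe (of_real K r * z) = r * sRe z.
Proof. by case: K z => //= -[a b] /=; rewrite mul0r subr0. Qed.

Lemma sconj_of_real (r : R) : sconj (of_real K r) = of_real K r.
Proof. by case: K => //; exact: (conjc_real r). Qed.

Lemma of_realK : cancel (@of_real R K) (@sRe R K).
Proof. by case: K. Qed.

Lemma conjM_real (z : F) : sconj z * z = of_real K (sRe (sconj z * z)).
Proof.
case: K z => //= -[a b] /=; apply/eqP; rewrite eq_complex /=.
by rewrite eqxx /= mulrC mulNr addrN.
Qed.

Lemma abs2_ge0 (z : F) : 0 <= sRe (sconj z * z).
Proof.
case: K z => /= [a|[a b] /=]; first by rewrite -expr2 sqr_ge0.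
by rewrite mulNr opprK addr_ge0 // -expr2 sqr_ge0.
Qed.

Lemma abs2_eq0 (z : F) : sRe (sconj z * z) = 0 -> z = 0.
Proof.
by move=> z0; apply/eqP; move: (conjM_real z); rewrite z0 rmorph0 => /eqP;
  rewrite mulf_eq0 fmorph_eq0 orbb.
Qed.

End Scalars.

(** * Hermitian squares of vectors *)

Section SquaredNorm.
Variables (R : realType) (K : scalar_kind).
Local Notation F := (base_field R K).

Lemma ctrmxM m n p (A : 'M[F]_(m, n)) (B : 'M[F]_(n, p)) :
  ctrmx (A *m B) = ctrmx B *m ctrmx A.
Proof. by rewrite /ctrmx map_mxM trmx_mul. Qed.

Lemma ctrmxD m n (A B : 'M[F]_(m, n)) : ctrmx (A + B) = ctrmx A + ctrmx B.
Proof. by rewrite /ctrmx map_mxD raddfD. Qed.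

Lemma ctrmxZ m n c (A : 'M[F]_(m, n)) : ctrmx (c *: A) = sconj c *: ctrmx A.
Proof. by rewrite /ctrmx map_mxZ linearZ. Qed.

Lemma ctrmxK m n (A : 'M[F]_(m, n)) : ctrmx (ctrmx A) = A.
Proof. by apply/matrixP=> i j; rewrite !mxE sconjK. Qed.

Lemma sRe_entryD (A B : 'M[F]_1) :
  sRe ((A + B) ord0 ord0) = sRe (A ord0 ord0) + sRe (B ord0 ord0).
Proof. by rewrite mxE raddfD. Qed.

Lemma sRe_entryZ (r : R) (A : 'M[F]_1) :
  sRe ((of_real K r *: A) ord0 ord0) = r * sRe (A ord0 ord0).
Proof. by rewrite mxE sRe_of_realM. Qed.

(** Unlike [norm2], it is free of square roots, so it obeys polynomial identities. *)
Definition sqnorm n (v : 'cV[F]_n) : R := sRe ((ctrmx v *m v) ord0 ord0).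

Lemma sqnorm_sum n (v : 'cV[F]_n) :
  sqnorm v = \sum_i sRe (sconj (v i ord0) * v i ord0).
Proof.
by rewrite /sqnorm mxE raddf_sum; apply: eq_bigr => i _; rewrite !mxE.
Qed.

Lemma sqnormE n (v : 'cV[F]_n) : (ctrmx v *m v) ord0 ord0 = of_real K (sqnorm v).
Proof.
rewrite sqnorm_sum mxE rmorph_sum; apply: eq_bigr => i _.
by rewrite !mxE; exact: conjM_real.
Qed.

Lemma sqnorm_ge0 n (v : 'cV[F]_n) : 0 <= sqnorm v.
Proof. by rewrite sqnorm_sum sumr_ge0 // => i _; apply: abs2_ge0. Qed.

Lemma sqnorm_eq0 n (v : 'cV[F]_n) : sqnorm v = 0 -> v = 0.
Proof.
move=> /eqP; rewrite sqnorm_sum psumr_eq0 => [/allP v0|i _]; last exact: abs2_ge0.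
apply/matrixP=> i j; rewrite ord1 mxE; apply/abs2_eq0/eqP.
by apply: v0; rewrite mem_index_enum.
Qed.

Lemma sqnormD n (v w : 'cV[F]_n) :
  sqnorm (v + w) = sqnorm v + 2 * sRe ((ctrmx w *m v) ord0 ord0) + sqnorm w.
Proof.
have crossC : sRe ((ctrmx v *m w) ord0 ord0) = sRe ((ctrmx w *m v) ord0 ord0).
  have -> : ctrmx w *m v = ctrmx (ctrmx v *m w) by rewrite ctrmxM ctrmxK.
  by rewrite [in RHS]mxE [in RHS]mxE sRe_conj.
by rewrite /sqnorm ctrmxD mulmxDl !mulmxDr !sRe_entryD crossC; ring.
Qed.

Lemma sqnormZ n c (v : 'cV[F]_n) : sqnorm (c *: v) = sRe (sconj c * c) * sqnorm v.
Proof.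
rewrite {1}/sqnorm ctrmxZ -scalemxAl -scalemxAr scalerA mxE [in LHS]conjM_real.
exact: sRe_of_realM.
Qed.

Lemma sqnormZ_real n (r : R) (v : 'cV[F]_n) :
  sqnorm (of_real K r *: v) = r ^+ 2 * sqnorm v.
Proof. by rewrite sqnormZ sconj_of_real -rmorphM of_realK expr2. Qed.

Lemma norm2_sqr n (v : 'cV[F]_n) : norm2 v ^+ 2 = sqnorm v.
Proof. exact: sqr_sqrtr (sqnorm_ge0 v). Qed.

Lemma norm2_eq1 n (v : 'cV[F]_n) : norm2 v = 1 <-> sqnorm v = 1.
Proof.
split=> [v1|v1]; first by rewrite -norm2_sqr v1 expr1n.
by rewrite /norm2 -/(sqnorm v) v1 sqrtr1.
Qed.

(** The constant [2 ^+ p] is crude, but it follows from the parallelosqnorm law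
    alone, without the Cauchy-Schwarz inequality; only its finiteness matters in
    [mulmx_bounded]. *)
Lemma sqnorm_sum_le n p (x : 'I_p -> 'cV[F]_n) :
  sqnorm (\sum_j x j) <= 2 ^+ p * \sum_j sqnorm (x j).
Proof.
elim: p x => [|p IHp] x.
  by rewrite !big_ord0 /sqnorm mulmx0 mxE raddf0 mulr0.
rewrite !big_ord_recl exprS; set y := \sum_(i < p) _; set g := \sum_(i < p) _.
have /= := IHp (fun i => x (lift ord0 i)); rewrite -/y -/g => leyg.
(* |a - b|^2 >= 0 gives |a + b|^2 <= 2 |a|^2 + 2 |b|^2. *)
have := sqnorm_ge0 (x ord0 + of_real K (-1) *: y).
rewrite !sqnormD sqnormZ_real ctrmxZ sconj_of_real -scalemxAl sRe_entryZ.
have : sqnorm (x ord0) <= 2 ^+ p * sqnorm (x ord0).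
  by rewrite ler_peMl ?sqnorm_ge0 // exprn_ege1 // ler1n.
rewrite mulrDr -!mulrA; lra.
Qed.

(** This makes the supremum in [spectral_norm] one of a bounded set, without
    which it would not be an upper bound. *)
Lemma mulmx_bounded m n (A : 'M[F]_(m, n)) :
  exists C : R, forall v : 'cV[F]_n, sqnorm (A *m v) <= C * sqnorm v.
Proof.
exists (2 ^+ n * \sum_j sqnorm (col j A)) => v.
have -> : A *m v = \sum_j v j ord0 *: col j A.
  apply/matrixP=> i j; rewrite ord1 mxE summxE.
  by apply: eq_bigr => l _; rewrite !mxE mulrC.
apply: le_trans (sqnorm_sum_le _) _; rewrite -mulrA ler_wpM2l ?exprn_ge0 //.
rewrite mulr_suml ler_sum // => j _; rewrite sqnormZ mulrC ler_wpM2l ?sqnorm_ge0 //.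
rewrite sqnorm_sum (bigD1 j) //= lerDl sumr_ge0 // => i _; exact: abs2_ge0.
Qed.

(** * Spectral norm and maximal singular vectors *)

Lemma norm2_le_spectral n (A : 'M[F]_n) (v : 'cV[F]_n) :
  norm2 v = 1 -> norm2 (A *m v) <= spectral_norm A.
Proof.
move=> v1; apply: ub_le_sup; last by exists v.
have [C AC] := mulmx_bounded A; exists (Num.sqrt C) => _ [u /norm2_eq1 u1 <-].
by rewrite ler_wsqrtr //; have := AC u; rewrite u1 mulr1.
Qed.

Lemma sqnorm_le_spectral n (A : 'M[F]_n) (v : 'cV[F]_n) :
  sqnorm (A *m v) <= spectral_norm A ^+ 2 * sqnorm v.
Proof.
have [v0|v_neq0] := eqVneq (sqnorm v) 0.
  by rewrite (sqnorm_eq0 v0) mulmx0 {1}/sqnorm mulmx0 mxE raddf0 mulr_ge0 ?sqr_ge0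
       ?sqnorm_ge0.
have v_gt0 : 0 < sqnorm v by rewrite lt_def v_neq0 sqnorm_ge0.
pose c : R := (norm2 v)^-1; pose w := of_real K c *: v.
have c2 : c ^+ 2 = (sqnorm v)^-1 by rewrite exprVn norm2_sqr.
have /norm2_eq1 w1 : sqnorm w = 1 by rewrite sqnormZ_real c2 mulVf.
have leAw := norm2_le_spectral A w1.
have : norm2 (A *m w) ^+ 2 <= spectral_norm A ^+ 2.
  by rewrite lerXn2r ?nnegrE ?sqrtr_ge0 // (le_trans _ leAw) ?sqrtr_ge0.
by rewrite norm2_sqr -scalemxAr sqnormZ_real c2 mulrC ler_pdivrMr.
Qed.

Lemma spectral_norm_gt0 n (A : 'M[F]_n) : A != 0 -> 0 < spectral_norm A.
Proof.
apply: contraNT; rewrite -leNgt => s_le0; apply/eqP/matrixP=> i j.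
have e1 : norm2 (delta_mx j ord0 : 'cV[F]_n) = 1.
  apply/norm2_eq1; rewrite sqnorm_sum (bigD1 j) //= big1 => [|l lj].
    by rewrite !mxE !eqxx mulr1 rmorph1 -(rmorph1 (of_real K)) of_realK addr0.
  by rewrite !mxE (negPf lj) mulr0 raddf0.
have /sqnorm_eq0/matrixP/(_ i ord0) : sqnorm (A *m delta_mx j ord0) = 0.
  have := le_trans (norm2_le_spectral A e1) s_le0.
  by rewrite -norm2_sqr le_eqVlt ltNge sqrtr_ge0 orbF => /eqP->; rewrite expr0n.
by rewrite -colE !mxE.
Qed.

Lemma sqnorm_mulmx n (A : 'M[F]_n) (v : 'cV[F]_n) :
  (ctrmx v *m (ctrmx A *m A) *m v) ord0 ord0 = of_real K (sqnorm (A *m v)).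
Proof. by rewrite -sqnormE ctrmxM !mulmxA. Qed.

(** The quadratic form [s ^+ 2 |x|^2 - |A x|^2] is nonnegative and vanishes at
    [v], so it is stationary there.  Up to a negative factor, its gradient at [v]
    is the vector [w] below; if [w] were nonzero, a small step from [v] along [w]
    would make the form negative. *)
Lemma maximizer_eigen n (A : 'M[F]_n) (v : 'cV[F]_n) :
  sqnorm (A *m v) = spectral_norm A ^+ 2 * sqnorm v ->
  ctrmx A *m (A *m v) = of_real K (spectral_norm A ^+ 2) *: v.
Proof.
set s2 := _ ^+ 2 => Av.
pose w := ctrmx A *m (A *m v) - of_real K s2 *: v.
suff /sqnorm_eq0/eqP : sqnorm w = 0 by rewrite subr_eq0 => /eqP.
have w_real : sRe ((ctrmx (A *m w) *m (A *m v)) ord0 ord0)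
    = sqnorm w + s2 * sRe ((ctrmx w *m v) ord0 ord0).
  rewrite ctrmxM -mulmxA.
  have -> : ctrmx A *m (A *m v) = w + of_real K s2 *: v by rewrite subrK.
  by rewrite mulmxDr -scalemxAr sRe_entryD sRe_entryZ.
pose q := s2 * sqnorm w - sqnorm (A *m w).
have q_ge0 : 0 <= q by rewrite subr_ge0 sqnorm_le_spectral.
have ineq t : 2 * t * sqnorm w <= t ^+ 2 * q.
  have := sqnorm_le_spectral A (v + of_real K t *: w).
  rewrite mulmxDr -scalemxAr (sqnormD v) (sqnormD (A *m v)) !sqnormZ_real.
  rewrite !ctrmxZ !sconj_of_real.
  rewrite -!scalemxAl !sRe_entryZ w_real Av -/s2 /q; lra.
(* Any step t with 0 < t * q < 2 |w|^2 contradicts |w| != 0; this one also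
   covers q = 0. *)
have := ineq (sqnorm w / (q + 1)); have := sqnorm_ge0 w.
move: (sqnorm w) => a a_ge0 h.
have q1 : 0 < q + 1 by lra.
have : a ^+ 2 * (q + 2) <= 0.
  have : 0 <= (q + 1) ^+ 2 * ((a / (q + 1)) ^+ 2 * q - 2 * (a / (q + 1)) * a).
    by rewrite mulr_ge0 ?sqr_ge0 // subr_ge0.
  suff -> : (q + 1) ^+ 2 * ((a / (q + 1)) ^+ 2 * q - 2 * (a / (q + 1)) * a)
    = - (a ^+ 2 * (q + 2)) by rewrite oppr_ge0.
  by field; rewrite gt_eqF.
rewrite pmulr_lle0 ?ltr_wpDl // => a2.
by apply/eqP; rewrite -sqrf_eq0 eq_le a2 sqr_ge0.
Qed.

Lemma maximizer_singular n (A : 'M[F]_n) (v : 'cV[F]_n) :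
  A != 0 -> sqnorm v = 1 -> sqnorm (A *m v) = spectral_norm A ^+ 2 ->
  right_singular_vector A (spectral_norm A) v.
Proof.
move=> /spectral_norm_gt0 s_gt0 v1 Av; have s_neq0 := lt0r_neq0 s_gt0.
split; first exact/norm2_eq1.
exists (of_real K (spectral_norm A)^-1 *: (A *m v)); split.
- by apply/norm2_eq1; rewrite sqnormZ_real Av exprVn mulVf // expf_neq0.
- by rewrite scalerA -rmorphM divff // rmorph1 scale1r.
- rewrite -scalemxAr maximizer_eigen ?v1 ?mulr1 // scalerA -rmorphM.
  by rewrite expr2 mulKf.
Qed.

(** Each maximal right singular vector satisfies this equation, and it is linear
    in [v], so it extends to their span. *)
Lemma singular_space_eigen n (A : 'M[F]_n) (v : 'cV[F]_n) :
  max_right_singular_space A v ->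
  ctrmx A *m (A *m v) = of_real K (spectral_norm A ^+ 2) *: v.
Proof.
case=> p [c [w [w_sing ->]]]; rewrite !mulmx_sumr scaler_sumr.
apply: eq_bigr => j _; have [_ [u [_ Aw Au]]] := w_sing j.
rewrite -!scalemxAr Aw -scalemxAr Au !scalerA rmorphXn /=; congr (_ *: _); ring.
Qed.

Lemma singular_space_sqnorm n (A : 'M[F]_n) (v : 'cV[F]_n) :
  max_right_singular_space A v -> sqnorm v = 1 ->
  sqnorm (A *m v) = spectral_norm A ^+ 2.
Proof.
move=> /singular_space_eigen Av v1.
by rewrite {1}/sqnorm ctrmxM -mulmxA Av -scalemxAr sRe_entryZ -/(sqnorm v) v1 mulr1.
Qed.

(** * Convex hulls of fields of values *)

Lemma lin_span_sub n (S : set 'cV[F]_n) (v : 'cV[F]_n) : S v -> lin_span S v.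
Proof.
move=> Sv; exists 1%N, (fun=> 1), (fun=> v); split=> //.
by rewrite big_ord1 scale1r.
Qed.

Definition mean_form n p (t : 'I_p -> R) (v : 'I_p -> 'cV[F]_n)
    (M : 'M[F]_n) : F :=
  \sum_j of_real K (t j) * (ctrmx (v j) *m M *m v j) ord0 ord0.

Lemma mean_form_is_linear n p (t : 'I_p -> R) (v : 'I_p -> 'cV[F]_n) :
  scalar (mean_form t v).
Proof.
move=> c M N; rewrite /mean_form mulr_sumr -big_split; apply: eq_bigr => j _ /=.
rewrite mulmxDr mulmxDl -scalemxAr -scalemxAl mxE [X in X + _]mxE.
by rewrite mulrDr mulrCA.
Qed.

HB.instance Definition _ n p t v :=
  GRing.isLinear.Build F 'M[F]_n F _ (@mean_form n p t v)
    (mean_form_is_linear t v).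

Lemma mean_form_sqnorm n p (t : 'I_p -> R) (v : 'I_p -> 'cV[F]_n) (A : 'M[F]_n) :
  mean_form t v (ctrmx A *m A) = of_real K (\sum_j t j * sqnorm (A *m v j)).
Proof.
rewrite rmorph_sum; apply: eq_bigr => j _.
by rewrite sqnorm_mulmx -rmorphM.
Qed.

Lemma mean_form_span n k p (t : 'I_p -> R) (v : 'I_p -> 'cV[F]_n)
    (D : 'M[F]_n) (X : k.-tuple 'M[F]_n) (Z : 'M[F]_n) :
  Z \in <<X>>%VS -> (forall i, mean_form t v (D *m tnth X i) = 0) ->
  mean_form t v (D *m Z) = 0.
Proof.
move=> /coord_span -> X0; rewrite mulmx_sumr linear_sum big1 // => i _.
by rewrite -scalemxAr linearZ /= -tnth_nth X0 mulr0.
Qed.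

(** Reads off, by choice, the unit vectors behind the points of a convex
    combination, so that hulls of different tuples can be compared on the same
    vectors. *)
Lemma cvx_fieldP n m (B : m.-tuple 'M[F]_n) (S : set 'cV[F]_n) x :
  cvx (field_on B S) x <->
  exists p (t : 'I_p -> R) (v : 'I_p -> 'cV[F]_n),
    [/\ forall j, 0 <= t j, \sum_j t j = 1, forall j, S (v j) /\ sqnorm (v j) = 1
      & forall i, x i ord0 = mean_form t v (tnth B i)].
Proof.
split=> [[p [t [w [t_ge0 t1 wB ->]]]]|[p [t [v [t_ge0 t1 Sv xE]]]]].
  have /choice[v vP] : forall j, exists v, (S v /\ sqnorm v = 1) /\
      \col_(i < m) (ctrmx v *m tnth B i *m v) ord0 ord0 = w j.
    by move=> j; have [v [Sv /norm2_eq1 v1] vw] := wB j; exists v.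
  exists p, t, v; split=> // [j|i]; first by have [] := vP j.
  rewrite summxE; apply: eq_bigr => j _.
  by have [_ <-] := vP j; rewrite !mxE.
exists p, t, (fun j => \col_(i < m) (ctrmx (v j) *m tnth B i *m v j) ord0 ord0).
split=> // [j|]; first by have [? /norm2_eq1] := Sv j; exists (v j).
apply/matrixP=> i j; rewrite ord1 xE summxE.
by apply: eq_bigr => l _; rewrite !mxE.
Qed.

Lemma eq_mean_form n p (t : 'I_p -> R) (v w : 'I_p -> 'cV[F]_n) :
  (forall j, t j != 0 -> v j = w j) -> mean_form t v =1 mean_form t w.
Proof.
move=> vw M; apply: eq_bigr => j _.
by have [->|/vw->//] := eqVneq (t j) 0; rewrite rmorph0 !mul0r.
Qed.

End SquaredNorm.

(** * The equivalence *)

Theorem theorem12 (R : realType) (K : scalar_kind) (n k : nat) (hk : (0 < k)%N)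
    (X : k.-tuple 'M[base_field R K]_n) (XX : {vspace 'M[base_field R K]_n})
    (hspan : XX = <<X>>%VS) (hdim : \dim XX = k)
    (Y Xs : 'M[base_field R K]_n) (hY : Y \notin XX) (hXs : Xs \in XX) :
  let A : k.-tuple 'M[base_field R K]_n :=
    [tuple of [seq ctrmx (Y - Xs) *m Xi | Xi <- X]] in
  let AY : 'M[base_field R K]_n := ctrmx (Y - Xs) *m Y in
  let rho : R := spectral_norm (Y - Xs) ^+ 2 in
  let e1 : 'cV[base_field R K]_(k.+1) := col ord0 1%:M in
  cvx (field_on A (max_right_singular_space (Y - Xs))) 0
  <-> cvx (field_of [tuple of AY :: A]) (of_real K rho *: e1).
Proof.
move=> A AY rho e1; set D := Y - Xs.
have D_neq0 : D != 0.
  by apply: contraNneq hY => /eqP; rewrite subr_eq0 => /eqP->.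
have Xs_span : Xs \in <<X>>%VS by rewrite -hspan.
have AE i : tnth A i = ctrmx D *m tnth X i by rewrite tnth_map.
have AYE : AY = ctrmx D *m D + ctrmx D *m Xs by rewrite -mulmxDr subrK.
have AY_mean p (t : 'I_p -> R) v : (forall i, mean_form t v (tnth A i) = 0) ->
    mean_form t v AY = of_real K (\sum_j t j * sqnorm (D *m v j)).
  move=> A0; rewrite AYE linearD /= mean_form_sqnorm.
  rewrite (mean_form_span Xs_span) ?addr0 //.
  by move=> i; rewrite -AE.
have e1_0 : (of_real K rho *: e1) ord0 ord0 = of_real K rho.
  by rewrite !mxE eqxx mulr1.
have e1_S i : (of_real K rho *: e1) (lift ord0 i) ord0 = 0.
  by rewrite !mxE mulr0.
split=> /cvx_fieldP[p [t [v [t_ge0 t1 Sv xE]]]].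
  have A0 i : mean_form t v (tnth A i) = 0 by rewrite -xE mxE.
  apply/cvx_fieldP; exists p, t, v; split=> // [j|i].
    by have [_] := Sv j.
  have [j ->|->] := unliftP ord0 i; first by rewrite e1_S tnthS A0.
  rewrite e1_0 tnth0 AY_mean //; congr of_real.
  rewrite -[LHS]mul1r -t1 mulr_suml; apply: eq_bigr => j _.
  by have [Svj v1] := Sv j; rewrite singular_space_sqnorm.
have A0 i : mean_form t v (tnth A i) = 0.
  by have := xE (lift ord0 i); rewrite e1_S tnthS.
have mean_rho : \sum_j t j * sqnorm (D *m v j) = rho.
  apply: (can_inj (@of_realK R K)); rewrite -AY_mean //.
  by rewrite -e1_0 xE tnth0.
have v_max j : t j != 0 -> sqnorm (D *m v j) = rho.
  apply: (mean_eq_max t_ge0 t1 _ mean_rho) => l.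
  by have [_ v1] := Sv l; have := sqnorm_le_spectral D (v l); rewrite v1 mulr1.
have [j0 tj0] := weight_neq0 t1.
(* Vectors of zero weight are unconstrained and may lie outside the maximal
   singular space; they are replaced by one that lies in it. *)
pose w j := if t j == 0 then v j0 else v j.
have vw : forall j, t j != 0 -> v j = w j.
  by move=> j /negPf tj; rewrite /w tj.
apply/cvx_fieldP; exists p, t, w; split=> // [j|i]; last first.
  by rewrite mxE -(eq_mean_form vw) A0.
have v_good l : t l != 0 -> max_right_singular_space D (v l) /\ sqnorm (v l) = 1.
  move=> tl; have [_ v1] := Sv l; split=> //.
  by apply/lin_span_sub/maximizer_singular => //; apply: v_max.
by rewrite /w; case: eqVneq => [_|]; apply: v_good.
Qed.
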